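(* Let $G_1=(V_1,E_1)$ (the demand graph) and $G_2=(V_2,E_2)$ (the supply graph) be finite undirected graphs, and let every node $v\in V_1$ have a nonempty set $S(v)\subseteq V_2$ of supply nodes. Let $\tilde G_1$ be the colored graph obtained from $G_1$ by the transformation described in the context. Then for every set $V_s\subseteq V_2$: $V_s$ is a supply node cut of $G_1$ if and only if $V_s$, regarded as a set of colors of $\tilde G_1$, is a color node cut of $\tilde G_1$. In this sense there is a one-to-one correspondence between supply node cuts of $G_1$ and color node cuts of $\tilde G_1$.
   Context: A node cut of a graph $H$ is a set $X$ of nodes of $H$ such that removing $X$ from $H$ either leaves a graph with more than one connected component or leaves exactly one node. A supply node cut of $G_1$ is a set $V_s\subseteq V_2$ such that the set $V_d=\{v\in V_1: S(v)\subseteq V_s\}$ of demand nodes having no supply node outside $V_s$ contains a node cut of $G_1$. A colored graph is a graph in which each node carries exactly one color. A color node cut of a colored graph $G$ is a set $C_c$ of colors such that the set of nodes of $G$ whose color lies in $C_c$ contains a node cut of $G$. The transformed graph $\tilde G_1$: for each $v\in V_1$ with $|S(v)|=n_s(v)$, $\tilde G_1$ contains $n_s(v)$ copies of $v$, one for each $u\in S(v)$, and that copy has color $u$ (so colors are elements of $V_2$); there are no edges between copies of the same node; if $v_iv_j\in E_1$ then every copy of $v_i$ is adjacent to every copy of $v_j$, and there are no other edges. *)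

(* Defs.v *)
From HB Require Import structures.
From mathcomp Require Import all_boot.

Set Implicit Arguments.
Unset Strict Implicit.
Unset Printing Implicit Defensive.

Record sgraph := SGraph {
  node :> finType;
  adj : rel node;
  adj_sym : symmetric adj;
  adj_irr : irreflexive adj
}.

Record cgraph (C : finType) := CGraph {
  cgraph_graph :> sgraph;
  color : cgraph_graph -> C
}.

Section Removal.
Variables (H : sgraph) (X : {set H}).

Definition removed_adj : rel {x : H | x \notin X} :=
  fun x y => adj (val x) (val y).

Lemma removed_adj_sym : symmetric removed_adj.
Proof. by move=> x y; apply: adj_sym. Qed.

Lemma removed_adj_irr : irreflexive removed_adj.
Proof. by move=> x; apply: adj_irr. Qed.

Definition remove_nodes : sgraph := SGraph removed_adj_sym removed_adj_irr.

End Removal.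

Definition n_components (H : sgraph) : nat := n_comp (@adj H) H.

Definition node_cut (H : sgraph) (X : {set H}) : Prop :=
  1 < n_components (remove_nodes X) \/ #|remove_nodes X| = 1.

Definition contains_node_cut (H : sgraph) (Y : {set H}) : Prop :=
  exists2 X : {set H}, X \subset Y & node_cut X.

Definition supply_node_cut (G1 G2 : sgraph) (S : G1 -> {set G2})
    (Vs : {set G2}) : Prop :=
  contains_node_cut [set v : G1 | S v \subset Vs].

Definition color_node_cut (C : finType) (G : cgraph C) (Cc : {set C}) : Prop :=
  contains_node_cut [set x : G | color x \in Cc].

Section Transformation.
Variables (G1 G2 : sgraph) (S : G1 -> {set G2}).

(* The pair (v, u) with u \in S v is the copy of v that has color u. *)
Definition copy : finType := {p : G1 * G2 | p.2 \in S p.1}.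

(* Copies of the same node are not adjacent because adj is irreflexive. *)
Definition copy_adj : rel copy := fun x y => adj (val x).1 (val y).1.

Lemma copy_adj_sym : symmetric copy_adj.
Proof. by move=> x y; apply: adj_sym. Qed.

Lemma copy_adj_irr : irreflexive copy_adj.
Proof. by move=> x; apply: adj_irr. Qed.

Definition transformed_graph : cgraph G2 :=
  @CGraph G2 (SGraph copy_adj_sym copy_adj_irr) (fun x : copy => (val x).2).

End Transformation.

(* Main.v *)
Require Import Defs.
From mathcomp Require Import all_boot.

(** Deleting all copies of a node cut [X] of [G1] from the transformed graph,
    or deleting from [G1] the nodes all of whose copies lie in a given cut of
    the transformed graph, leaves two graphs related by a surjection [f] with
    [adj (f x) (f y) = adj x y], i.e. one is a blow-up of the other by
    independent sets.  Such a surjection preserves and reflects the property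
    of being disconnected or a single node: two nodes of a common fibre can
    only be disconnected from each other if their image is isolated. *)

Lemma n_components_gt1 (H : sgraph) :
  1 < n_components H <-> exists x y : H, ~~ connect (@adj H) x y.
Proof.
have csym : connect_sym (@adj H).
  by apply: sym_connect_sym; apply: adj_sym.
split.
  case/card_gt1P=> x [y [/andP[/= rx _] /andP[/= ry _] xy]].
  exists x, y; rewrite -(root_connect csym).
  by rewrite (eqP rx) (eqP ry).
case=> x [y]; rewrite -(root_connect csym) => nxy.
apply/card_gt1P; exists (root (@adj H) x), (root (@adj H) y).
by rewrite !inE !(roots_root csym).
Qed.

Section BlowUp.
Variables (H K : sgraph) (f : H -> K).
Hypothesis f_surj : forall a : K, exists x : H, f x = a.
Hypothesis f_adj : forall x y : H, adj (f x) (f y) = adj x y.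

Lemma blow_up_connect x y :
  connect (@adj H) x y -> connect (@adj K) (f x) (f y).
Proof.
case/connectP=> p; elim: p x => [|z p IH] x /=; first by move=> _ ->.
case/andP=> xz pz ly; apply: connect_trans (IH _ pz ly).
by apply: connect1; rewrite f_adj.
Qed.

(** Paths lift node by node: any preimage of the next node will do, since adjacency depends only on
    the images. The end [z] of the lift is controlled only up to its fibre. *)
Lemma blow_up_lift_connect x b :
  connect (@adj K) (f x) b -> exists2 z, f z = b & connect (@adj H) x z.
Proof.
case/connectP=> p; elim: p x => [|c p IH] x /=; first by move=> _ ->; exists x.
have [y <-] := f_surj c; rewrite f_adj => /andP[xy py] lb.
have [z zb yz] := IH _ py lb.
by exists z => //; apply: connect_trans yz; apply: connect1.
Qed.

Lemma blow_up_disconnected_or_single :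
  (1 < n_components H \/ #|H| = 1) <-> (1 < n_components K \/ #|K| = 1).
Proof.
split; case.
- case/n_components_gt1=> x [y nxy].
  have [/blow_up_lift_connect[z fzy xz]|nfxy] :=
    boolP (connect (@adj K) (f x) (f y)); last first.
    by left; apply/n_components_gt1; exists (f x), (f y).
  (* [z] and [y] lie in one fibre, so they have the same neighbours: a neighbour [w] of [y] would
     connect [x] to [y] through [z] and [w]. *)
  have isolated c : ~~ adj (f y) c.
    have [w <-] := f_surj c; apply: contra nxy => yw.
    apply: (connect_trans xz); apply: (connect_trans (y := w)).
      by apply: connect1; rewrite -f_adj fzy.
    by apply: connect1; rewrite adj_sym -f_adj.
  have [/existsP[b nb]|/existsPn all_fy] := boolP [exists b, b != f y].
    left; apply/n_components_gt1; exists (f y), b.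
    apply: contra nb => /connectP[[|c p] /= + ->] //.
    by rewrite (negPf (isolated c)).
  right; apply: (@eq_card1 _ (f y)) => b.
  by rewrite !inE; move: (all_fy b); rewrite negbK => ->.
- move=> cardH; right; have [x Hx] := fintype1 cardH.
  apply: (@eq_card1 _ (f x)) => b; rewrite !inE.
  by have [z <-] := f_surj b; rewrite (Hx z) eqxx.
- case/n_components_gt1=> a [b nab].
  have [x fx] := f_surj a; have [y fy] := f_surj b.
  left; apply/n_components_gt1; exists x, y.
  by apply: contra nab => /blow_up_connect; rewrite fx fy.
- move=> cardK; have [a Ka] := fintype1 cardK.
  (* The only node of [K] carries no loop, so [H] has no edges. *)
  have noedge (x y : H) : adj x y = false.
    by rewrite -f_adj (Ka (f x)) (Ka (f y)) adj_irr.
  have [x _] := f_surj a.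
  have [/existsP[y nyx]|/existsPn all_x] := boolP [exists y, y != x].
    left; apply/n_components_gt1; exists x, y.
    by apply: contra nyx => /connectP[[|c p] /= + ->] //; rewrite noedge.
  right; apply: (@eq_card1 _ x) => y.
  by rewrite !inE; move: (all_x y); rewrite negbK => ->.
Qed.

End BlowUp.

(** The hypothesis makes the projection of copies to nodes a well-defined surjection between the
    remaining graphs. *)
Lemma node_cut_transformed (G1 G2 : sgraph) (S : G1 -> {set G2})
    (X : {set G1}) (Y : {set transformed_graph S}) :
    (forall v, v \notin X <->
       exists2 x : transformed_graph S, (val x).1 = v & x \notin Y) ->
  node_cut Y <-> node_cut X.
Proof.
move=> XY.
have fP (x : {x : transformed_graph S | x \notin Y}) : (val (val x)).1 \notin X.
  by apply/XY; exists (val x); last exact: (valP x).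
pose f x : remove_nodes X := Sub (val (val x)).1 (fP x).
apply: (@blow_up_disconnected_or_single (remove_nodes Y) (remove_nodes X) f).
  move=> a; have /XY[x xa xY] := valP a.
  by exists (Sub x xY); apply: val_inj.
by [].
Qed.

Theorem theorem1 (G1 G2 : sgraph) (S : G1 -> {set G2})
    (S_neq0 : forall v : G1, S v != set0) (Vs : {set G2}) :
  supply_node_cut S Vs <-> color_node_cut (transformed_graph S) Vs.
Proof.
split=> -[].
- move=> X /subsetP XVs cutX.
  exists [set x : transformed_graph S | (val x).1 \in X].
    apply/subsetP=> x; rewrite !inE => /XVs; rewrite inE => /subsetP; apply.
    exact: (valP x).
  apply: (proj2 (node_cut_transformed _ _ _ X _ _)) cutX => v.
  split=> [vX|[x <-]]; last by rewrite inE.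
  (* Nonemptiness of [S v] gives each remaining node a remaining copy. *)
  have /set0Pn[u uSv] := S_neq0 v.
  by exists (Sub (v, u) uSv) => //; rewrite inE.
- move=> Y /subsetP YVs cutY.
  exists [set v | [forall x : transformed_graph S,
                     ((val x).1 == v) ==> (x \in Y)]].
    (* Each [u] in [S v] is the color of a copy of [v]; that copy is in [Y], so [u] is in [Vs]. *)
    apply/subsetP=> v; rewrite !inE => /forallP allY; apply/subsetP=> u uSv.
    have /implyP/(_ (eqxx _))/YVs := allY (Sub (v, u) uSv).
    by rewrite inE.
  apply: (proj1 (node_cut_transformed _ _ _ _ Y _)) cutY => v.
  rewrite inE; split.
    by case/forallPn=> x; rewrite negb_imply => /andP[/eqP xv xY]; exists x.
  by case=> x xv xY; apply/forallPn; exists x; rewrite negb_imply xv eqxx.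
Qed.
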